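(* Let $n>2$ be even and let $a_1,\dots,a_n$ be integers. Then the pretzel diagram $P=P(a_1,\dots,a_n)$ satisfies $P=\hat\beta$ where $$\beta=[1\uparrow (n-2)]\;(n-1)^{a_1}(n-3)^{a_3}\cdots 1^{a_{n-1}}\;[-(n-2)\uparrow -1]\;(n-1)^{a_2}(n-3)^{a_4}\cdots 1^{a_n}.$$ The braid $\beta$ has $n$ strands and $2n+\sum_{i=1}^n|a_i|-4$ crossings.
   Context: Pretzel diagram: for integers $a_1,\dots,a_n$, $P(a_1,\dots,a_n)$ is the link diagram formed by $n$ vertical two-strand twist columns placed side by side from left to right, the $i$-th column consisting of $|a_i|$ crossings all of the same type, that type being determined by the sign $a_i/|a_i|$ (no crossings if $a_i=0$); the top-right end of column $i$ is joined to the top-left end of column $i+1$ and likewise at the bottom, and the top-left end of column $1$ is joined to the top-right end of column $n$ by an arc running over the top, and likewise at the bottom. Crossing-sign and braid-generator conventions are the standard ones of Lickorish's book, under which e.g. $P(a,b)$ is the closure of $\sigma_1^{a+b}$. ''$P=\hat\beta$'' means the link represented by $P$ is isotopic to the closure of the braid $\beta$. Braid-word notation: a sequence of nonzero integers $(m_1,\dots,m_k)$ denotes $\sigma_{|m_1|}^{\epsilon_1}\cdots\sigma_{|m_k|}^{\epsilon_k}$ with $\epsilon_i=m_i/|m_i|$; juxtaposition is concatenation. For a positive integer $k$ and an integer $e$, $k^{e}$ denotes $\sigma_k^{e}$. For integers $i,j$: $[i\uparrow j]=(i,i+1,\dots,j)$ if $i\le j$ and $ij>0$, and is the empty word otherwise.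 Thus $[1\uparrow(n-2)]=\sigma_1\sigma_2\cdots\sigma_{n-2}$ and $[-(n-2)\uparrow-1]=\sigma_{n-2}^{-1}\cdots\sigma_1^{-1}$. *)

(* Defs.v *)
(* Combinatorial model of unoriented link diagrams:
   Morse (plat) words of elementary tangles, modulo planar isotopy and
   Reidemeister moves (Turaev's presentation of the unoriented tangle category). *)
From mathcomp Require Import all_boot all_order all_algebra.
Set Implicit Arguments. Unset Strict Implicit. Unset Printing Implicit Defensive.
Import Order.TTheory GRing.Theory Num.Theory.

(* Elementary pieces, read from bottom to top, acting on a row of points
   numbered 0,1,2,... from left to right:
   - [Cup i]     : a minimum; creates two new points at positions i, i+1
                   (old points at positions >= i move 2 to the right);
   - [Cap i]     : a maximum; joins the points at positions i, i+1;
   - [Cross i s] : a crossing of the strands at positions i, i+1; with s = true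
                   it is the crossing of the braid generator sigma_(i+1),
                   with s = false that of sigma_(i+1)^-1 (Lickorish). *)
Inductive gen := Cup of nat | Cap of nat | Cross of nat & bool.

Definition tangle := seq gen.

Definition gpos (g : gen) : nat :=
  match g with Cup i => i | Cap i => i | Cross i _ => i end.
Definition gin (g : gen) : nat :=
  match g with Cup _ => 0 | Cap _ => 2 | Cross _ _ => 2 end.
Definition gout (g : gen) : nat :=
  match g with Cup _ => 2 | Cap _ => 0 | Cross _ _ => 2 end.
Definition setpos (g : gen) (p : nat) : gen :=
  match g with Cup _ => Cup p | Cap _ => Cap p | Cross _ s => Cross p s end.

Fixpoint wt (k : nat) (w : tangle) : option nat :=
  match w with
  | [::] => Some k
  | g :: w' => if (gpos g + gin g <= k)%N then wt (k + gout g - gin g)%N w' else None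
  end.

Definition closed (w : tangle) : Prop := wt 0 w = Some 0%N.

Inductive lmove : tangle -> tangle -> Prop :=
  (* planar isotopy: height exchange of two events in disjoint regions *)
  | lm_far g h : (gpos g + gout g <= gpos h)%N ->
      lmove [:: g; h] [:: setpos h (gpos h - gout g + gin g)%N; g]
  | lm_snake1 i : lmove [:: Cup i.+1; Cap i] [::]
  | lm_snake2 i : lmove [:: Cup i; Cap i.+1] [::]
  (* planar isotopy: moving a strand across an extremum (sliding a crossing) *)
  | lm_slide_cup i s : lmove [:: Cup i; Cross i.+1 s] [:: Cup i.+1; Cross i (~~ s)]
  | lm_slide_cap i s : lmove [:: Cross i.+1 s; Cap i] [:: Cross i (~~ s); Cap i.+1]
  | lm_r1_cup i s : lmove [:: Cup i; Cross i s] [:: Cup i]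
  | lm_r1_cap i s : lmove [:: Cross i s; Cap i] [:: Cap i]
  | lm_r2 i s : lmove [:: Cross i s; Cross i (~~ s)] [::]
  | lm_r3 i : lmove [:: Cross i true; Cross i.+1 true; Cross i true]
                    [:: Cross i.+1 true; Cross i true; Cross i.+1 true].

Inductive dstep : tangle -> tangle -> Prop :=
  | DStep u v l r : lmove l r -> closed (u ++ l ++ v) -> closed (u ++ r ++ v) ->
      dstep (u ++ l ++ v) (u ++ r ++ v).

Inductive iso : tangle -> tangle -> Prop :=
  | iso_refl w : iso w w
  | iso_step w1 w2 : dstep w1 w2 -> iso w1 w2
  | iso_sym w1 w2 : iso w1 w2 -> iso w2 w1
  | iso_trans w1 w2 w3 : iso w1 w2 -> iso w2 w3 -> iso w1 w3.

(* Pretzel diagram P(a_1,...,a_n): column i (0-based) occupies positions 2i, 2i+1 *)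
Definition column (j : nat) (x : int) : tangle := nseq (absz x) (Cross j (0 < x)%R).

Definition pretzel (a : seq int) : tangle :=
  Cup 0 :: nseq (size a).-1 (Cup 1)
  ++ flatten [seq column (2 * i) (nth 0%R a i) | i <- iota 0 (size a)]
  ++ nseq (size a).-1 (Cap 1) ++ [:: Cap 0].

(* Braid words: sequences of nonzero integers, m standing for sigma_|m|^(sign m) *)
Definition bgen (m : int) : gen := Cross (absz m).-1 (0 < m)%R.

(* closure of a braid on n strands (closing arcs on the right) *)
Definition bclosure (n : nat) (b : seq int) : tangle :=
  [seq Cup i | i <- iota 0 n] ++ map bgen b ++ [seq Cap (n.-1 - i)%N | i <- iota 0 n].

Definition bpow (k : nat) (e : int) : seq int :=
  nseq (absz e) (if (0 <= e)%R then (k%:Z)%R else (- k%:Z)%R).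

Definition bup (i j : int) : seq int :=
  if ((i <= j) && (0 < i * j))%R then [seq (i + k%:Z)%R | k <- iota 0 (absz (j - i)).+1]
  else [::].

Definition beta (n : nat) (a : seq int) : seq int :=
  bup 1 (n%:Z - 2)%R
  ++ flatten [seq bpow (n - 1 - 2 * k) (nth 0%R a (2 * k)) | k <- iota 0 n./2]
  ++ bup (- (n%:Z - 2))%R (-1)%R
  ++ flatten [seq bpow (n - 1 - 2 * k) (nth 0%R a (2 * k).+1) | k <- iota 0 n./2].

(* Main.v *)
Require Import Defs.
From mathcomp Require Import all_boot all_order all_algebra.
From mathcomp Require Import zify.
Set Implicit Arguments. Unset Strict Implicit. Unset Printing Implicit Defensive.

(* Take the diagram with all columns of the pretzel above its cups, followed by a
   braid S and its inverse. Cancelling S gives back the pretzel. Instead, S may be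
   pushed down through the columns and absorbed by the cups. It carries the even
   columns (counting from 0), in reverse order, to the left of the odd ones and gives
   each even column but the first a half twist; this turns the side-by-side cups into
   nested cups followed by sigma_1 ... sigma_(n-2), on the left half of the strands.
   The inverse of S meets the caps in the mirror image of this picture. Finally the odd
   columns, on the right half, slide around the nested caps to the left half. *)

(** * Typing of words and directed rewriting *)

Lemma wt_cat k u v : wt k (u ++ v) = obind (wt^~ v) (wt k u).
Proof. by elim: u k => //= g u IH k; case: ifP. Qed.

Lemma wt_catS k l m u v :
  wt k u = Some l -> wt l v = Some m -> wt k (u ++ v) = Some m.
Proof. by move=> hu hv; rewrite wt_cat hu. Qed.

Lemma wt_consP k g w m : wt k (g :: w) = Some m ->
  gpos g + gin g <= k /\ wt (k + gout g - gin g) w = Some m.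
Proof. by move=> /=; case: ifP. Qed.

Lemma wt1P k g m :
  wt k [:: g] = Some m <-> gpos g + gin g <= k /\ k + gout g - gin g = m.
Proof. by rewrite /=; case: ifP => h; split=> [|[]] // => [[<-]|_ ->]. Qed.

Lemma wt_catP k u v m : wt k (u ++ v) = Some m ->
  exists2 l, wt k u = Some l & wt l v = Some m.
Proof. by rewrite wt_cat; case: (wt k u) => //= l; exists l. Qed.

Definition braid k : pred tangle :=
  all (fun g => if g is Cross i _ then i.+1 < k else false).

Lemma wt_braid k w : braid k w -> wt k w = Some k.
Proof.
by elim: w => //= -[//|//|i s] w IH /andP[ik /IH hw]; rewrite /= addn2 ik addnK.
Qed.

(* A directed move in context: whenever the source is well typed there, so is the
   target, and the closed-up diagrams are isotopic. It need not be symmetric, since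
   a word may be typed on fewer strands after a simplification. *)
Definition red_body (w1 w2 : tangle) : Prop :=
  forall k m u v, wt 0 u = Some k -> wt k w1 = Some m -> wt m v = Some 0 ->
  wt k w2 = Some m /\ iso (u ++ w1 ++ v) (u ++ w2 ++ v).

Variant red (w1 w2 : tangle) : Prop := Red of red_body w1 w2.

Lemma redP w1 w2 : red w1 w2 -> red_body w1 w2.
Proof. by case. Qed.

Lemma red_refl w : red w w.
Proof. by apply: Red => k m u v _ hw _; split=> //; apply: iso_refl. Qed.

Lemma red_trans w2 w1 w3 : red w1 w2 -> red w2 w3 -> red w1 w3.
Proof.
move=> [h12] [h23]; apply: Red => k m u v hu h1 hv.
have [h2 i12] := h12 _ _ _ _ hu h1 hv.
by have [h3 i23] := h23 _ _ _ _ hu h2 hv; split=> //; apply: iso_trans i12 i23.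
Qed.

Lemma red_ctx u v l r : red l r -> red (u ++ l ++ v) (u ++ r ++ v).
Proof.
move=> [h]; apply: Red => k m u' v' hu' /wt_catP[p hu /wt_catP[q hl hv]] hv'.
have [||hr i] := h _ _ (u' ++ u) (v ++ v') _ hl.
- exact: wt_catS hu.
- exact: wt_catS hv'.
split; first by apply: wt_catS hu _; apply: wt_catS hv.
by move: i; rewrite -!catA.
Qed.

Lemma red_catl u l r : red l r -> red (u ++ l) (u ++ r).
Proof. by move=> /(@red_ctx u [::]); rewrite !cats0. Qed.

Lemma red_catr v l r : red l r -> red (l ++ v) (r ++ v).
Proof. exact: (@red_ctx [::] v). Qed.

Lemma red_cons g l r : red l r -> red (g :: l) (g :: r).
Proof. exact: (@red_catl [:: g]). Qed.

(** In use, [z] is [l] with cancelling pairs inserted. Passing from [l] up to [z] runs a reduction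
    backwards, so the typability of [z] has to be supplied. *)
Lemma red_span z l r : red z l -> red z r ->
  (forall k m, wt k l = Some m -> wt k z = Some m) -> red l r.
Proof.
move=> [hl] [hr] hz; apply: Red => k m u v hu hk hv.
have [_ il] := hl _ _ _ _ hu (hz _ _ hk) hv.
have [h ir] := hr _ _ _ _ hu (hz _ _ hk) hv.
by split=> //; apply: iso_trans (iso_sym il) ir.
Qed.

Ltac wt_lia := move=> /=; repeat case: ifP; move=> *; try discriminate;
  match goal with
  | H : Some _ = Some _ |- _ => case: H => H; first [congr Some; lia | exfalso; lia]
  end.

Lemma lmove_wt l r k m : lmove l r -> wt k l = Some m -> wt k r = Some m.
Proof.
by case=> [[i|i|i s] [j|j|j t]|i|i|i s|i s|i s|i s|i s|i]; wt_lia.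
Qed.

Lemma lmove_red l r : lmove l r -> red l r.
Proof.
move=> hlr; apply: Red => k m u v hu hl hv; have hr := lmove_wt hlr hl; split=> //.
by apply: iso_step; apply: DStep => //; apply: wt_catS hu _; apply: wt_catS hv.
Qed.

Lemma lmoveV_red l r : lmove l r ->
  (forall k m, wt k r = Some m -> wt k l = Some m) -> red r l.
Proof. by move=> h; exact: (red_span (lmove_red h) (red_refl l)). Qed.

(** * Elementary moves and signed braid relations as rewrites *)

Lemma red_far g h p : gpos g + gout g <= gpos h -> p + gout g = gpos h + gin g ->
  red [:: g; h] [:: setpos h p; g].
Proof.
move=> gh hp; have -> : p = gpos h - gout g + gin g by lia.
exact/lmove_red/lm_far.
Qed.

Lemma red_farV g h p : gpos g + gout g <= gpos h -> p + gout g = gpos h + gin g ->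
  red [:: setpos h p; g] [:: g; h].
Proof.
move=> gh hp; have hp' : p = gpos h - gout g + gin g by lia.
rewrite hp'; apply: lmoveV_red; first exact: lm_far.
by move: gh {hp hp'}; case: g h => [i|i|i s] [j|j|j t] /= gh k m; wt_lia.
Qed.

Lemma red_slide_cup i s : red [:: Cup i; Cross i.+1 s] [:: Cup i.+1; Cross i (~~ s)].
Proof. exact/lmove_red/lm_slide_cup. Qed.

Lemma red_slide_cap i s : red [:: Cross i.+1 s; Cap i] [:: Cross i (~~ s); Cap i.+1].
Proof. exact/lmove_red/lm_slide_cap. Qed.

Lemma red_r1_cup i s : red [:: Cup i; Cross i s] [:: Cup i].
Proof. exact/lmove_red/lm_r1_cup. Qed.

Lemma red_r2 i s : red [:: Cross i s; Cross i (~~ s)] [::].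
Proof. exact/lmove_red/lm_r2. Qed.

Lemma red_r3 i : red [:: Cross i true; Cross i.+1 true; Cross i true]
                     [:: Cross i.+1 true; Cross i true; Cross i.+1 true].
Proof. exact/lmove_red/lm_r3. Qed.

Lemma red_r3V i : red [:: Cross i.+1 true; Cross i true; Cross i.+1 true]
                      [:: Cross i true; Cross i.+1 true; Cross i true].
Proof. apply: lmoveV_red; first exact: lm_r3. by move=> k m; wt_lia. Qed.

Lemma red_step w u l r v : red l r -> red (u ++ r ++ v) w -> red (u ++ l ++ v) w.
Proof. by move=> h; apply: red_trans; apply: red_ctx. Qed.

(** For a negative crossing, a cancelling pair is inserted on the right, the positive braid relation
    is applied in the middle, and a pair cancels on the left. The free sign [e] lets crossings of
    either sign pass positive braids. *)
Lemma red_r3_up i e : red [:: Cross i e; Cross i.+1 true; Cross i true]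
                          [:: Cross i.+1 true; Cross i true; Cross i.+1 e].
Proof.
case: e; first exact: red_r3.
apply: (@red_span [:: Cross i false; Cross i.+1 true; Cross i true; Cross i.+1 true;
                    Cross i.+1 false]).
- apply: (red_step (u := [:: _; _; _]) (v := [::]) (red_r2 _ true)).
  exact: red_refl.
- apply: (red_step (u := [:: _]) (v := [:: _]) (red_r3V i)).
  apply: (red_step (u := [::]) (v := [:: _; _; _]) (red_r2 _ false)).
  exact: red_refl.
- by move=> k m; wt_lia.
Qed.

Lemma red_r3_down i e : red [:: Cross i.+1 e; Cross i true; Cross i.+1 true]
                            [:: Cross i true; Cross i.+1 true; Cross i e].
Proof.
case: e; first exact: red_r3V.
apply: (@red_span [:: Cross i.+1 false; Cross i true; Cross i.+1 true; Cross i true;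
                    Cross i false]).
- apply: (red_step (u := [:: _; _; _]) (v := [::]) (red_r2 _ true)).
  exact: red_refl.
- apply: (red_step (u := [:: _]) (v := [:: _]) (red_r3 i)).
  apply: (red_step (u := [::]) (v := [:: _; _; _]) (red_r2 _ false)).
  exact: red_refl.
- by move=> k m; wt_lia.
Qed.

(** The spanning word is the left side, then a positive word, then the right side. The positive word
    cancels against the left side as it stands, and against the right side after one positive braid
    relation. This is the reflection of [lm_r3]. *)
Lemma red_r3_neg i : red [:: Cross i false; Cross i.+1 false; Cross i false]
                         [:: Cross i.+1 false; Cross i false; Cross i.+1 false].
Proof.
pose x s := Cross i s; pose y s := Cross i.+1 s.
apply: (@red_span [:: x false; y false; x false; x true; y true; x true;
                      y false; x false; y false]).
- apply: (red_step (u := [:: _; _; _]) (v := [:: _; _; _]) (red_r3 i)).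
  apply: (red_step (u := [:: _; _; _; _; _]) (v := [:: _; _]) (red_r2 _ true)).
  apply: (red_step (u := [:: _; _; _; _]) (v := [:: _]) (red_r2 _ true)).
  apply: (red_step (u := [:: _; _; _]) (v := [::]) (red_r2 _ true)).
  exact: red_refl.
- apply: (red_step (u := [:: _; _]) (v := [:: _; _; _; _; _]) (red_r2 _ false)).
  apply: (red_step (u := [:: _]) (v := [:: _; _; _; _]) (red_r2 _ false)).
  apply: (red_step (u := [::]) (v := [:: _; _; _]) (red_r2 _ false)).
  exact: red_refl.
- move=> k m hk; have ik : i.+2 < k by case/wt_consP: hk => _ /wt_consP[/=]; lia.
  by rewrite -hk !wt_braid //= ik ltnW.
Qed.

(** * Reflection in a horizontal line *)

Definition flipg (g : gen) : gen :=
  match g with Cup i => Cap i | Cap i => Cup i | Cross i s => Cross i (~~ s) end.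

Definition flip (w : tangle) : tangle := rev (map flipg w).

Lemma flipK : involutive flip.
Proof.
move=> w; rewrite /flip map_rev revK -map_comp -[RHS]map_id.
by apply: eq_map => -[i|i|i s] //=; rewrite negbK.
Qed.

Lemma flip_cat u v : flip (u ++ v) = flip v ++ flip u.
Proof. by rewrite /flip map_cat rev_cat. Qed.

Lemma flip_cons g w : flip (g :: w) = flip w ++ [:: flipg g].
Proof. exact: (flip_cat [:: g]). Qed.

Lemma wt_flip k w m : wt k w = Some m -> wt m (flip w) = Some k.
Proof.
elim: w k => [|g w IH] k; first by move=> [->].
move=> /wt_consP[hg hw]; rewrite flip_cons; apply: wt_catS (IH _ hw) _.
by apply/wt1P; case: g hg {hw} => [i|i|i s] /=; lia.
Qed.

(** A reflected height exchange is a height exchange read backwards, whence the disjunction; each of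
    the other moves reflects to a rewrite in its own direction. *)
Lemma lmove_flip l r : lmove l r -> red (flip l) (flip r) \/ red (flip r) (flip l).
Proof.
case=> [g h gh|i|i|i s|i s|i s|i s|i s|i].
- right; set p := (X in setpos h X).
  have -> : flip [:: g; h] = [:: setpos (flipg (setpos h p)) (gpos h); flipg g].
    by case: h @p gh.
  by apply: red_far; move: gh; rewrite /p; case: g h {p} => [i|i|i s] [j|j|j t] /=; lia.
- by left; apply/lmove_red/lm_snake2.
- by left; apply/lmove_red/lm_snake1.
- by left; apply: red_slide_cap i (~~ s).
- by left; apply: red_slide_cup i (~~ s).
- by left; apply/lmove_red/lm_r1_cap.
- by left; apply/lmove_red/lm_r1_cup.
- by left; rewrite /flip /= /rev /= negbK; apply: red_r2.
- by left; apply: red_r3_neg.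
Qed.

Lemma iso_flip w1 w2 : iso w1 w2 -> iso (flip w1) (flip w2).
Proof.
elim=> [w|_ _ [u v l r hlr hl hr]|w1' w2' _ IH|w1' w2' w3' _ IH1 _ IH2].
- exact: iso_refl.
- move: (wt_flip hl) (wt_flip hr); rewrite !flip_cat -!catA.
  move=> /wt_catP[k hv /wt_catP[m hl' hu]] /wt_catP[k']; rewrite hv => -[<-].
  case/wt_catP=> m' hr' hu'.
  case: (lmove_flip hlr) => [[h]|[h]].
    by have [] := h _ _ _ _ hv hl' hu.
  by apply: iso_sym; have [] := h _ _ _ _ hv hr' hu'.
- exact: iso_sym.
- exact: iso_trans IH1 IH2.
Qed.

(** What is proved for the cups at the bottom of a diagram thus holds, reflected, for the caps at
    the top. *)
Lemma red_flip l r : red l r -> red (flip l) (flip r).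
Proof.
move=> [h]; apply: Red => k m u v hu hl hv.
have hl' := wt_flip hl; rewrite flipK in hl'.
have [hr i] := h _ _ _ _ (wt_flip hv) hl' (wt_flip hu).
split; first exact: wt_flip.
by have := iso_flip i; rewrite !flip_cat !flipK -!catA.
Qed.

(** * Shifts and commutation of distant words *)

Definition sh d (w : tangle) : tangle := [seq setpos g (gpos g + d) | g <- w].

Lemma sh_cat d u v : sh d (u ++ v) = sh d u ++ sh d v.
Proof. exact: map_cat. Qed.

Lemma sh_sh d e w : sh d (sh e w) = sh (e + d) w.
Proof. by rewrite /sh -map_comp; apply: eq_map => -[i|i|i s] /=; rewrite addnA. Qed.

Lemma wt_sh d k w m : wt k w = Some m -> wt (k + d) (sh d w) = Some (m + d).
Proof.
elim: w k => [|g w IH] k; first by move=> [->].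
move=> /wt_consP[hg /IH] /=.
have -> : k + gout g - gin g + d = k + d + gout g - gin g by lia.
by case: g hg => [i|i|i s] /= hg h; rewrite ifT //; lia.
Qed.

(** The word [h] acts to the right of [w], which changes the number of strands from [k] to [m];
    hence the shift of [h] depends on its height. Both directions are given because [red] is not
    symmetric. *)
Lemma red_far_word k m w h : wt k w = Some m ->
  red (w ++ sh m h) (sh k h ++ w) /\ red (sh k h ++ w) (w ++ sh m h).
Proof.
elim: w k => [|g w IH] k.
  by move=> [->]; rewrite cats0; split; apply: red_refl.
move=> /wt_consP[hg /IH[h1 h2]]; set p := k + gout g - gin g in h1 h2.
(* The first letter of [w] passes the whole of [h], by an inner induction on [h]. *)
have [g1 g2] : red (g :: sh p h) (rcons (sh k h) g) /\
               red (rcons (sh k h) g) (g :: sh p h).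
  have gE : p + gin g = k + gout g by rewrite /p; lia.
  elim: (h) => [|x h' [IH1 IH2]]; first by split; apply: red_refl.
  have -> : sh k (x :: h') = setpos (setpos x (gpos x + p)) (gpos x + k) :: sh k h'.
    by case: x.
  rewrite [sh p _]/=; split.
    apply: red_trans (red_cons _ IH1).
    apply: (@red_ctx [::] _ [:: _; _] [:: _; _]).
    by apply: red_far; case: x; move=> /=; lia.
  apply: red_trans (red_cons _ IH2) _.
  apply: (@red_ctx [::] _ [:: _; _] [:: _; _]).
  by apply: red_farV; case: x; move=> /=; lia.
split.
  apply: red_trans (red_cons _ h1) _.
  by rewrite -cat_cons -cat_rcons; apply: red_catr.
by rewrite -cat_rcons; apply: red_trans (red_catr _ g2) (red_cons _ h2).
Qed.

(** * Carrying a pair of strands to the far left *)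

(* Carries the strands at q, q+1 in parallel to the far left. *)
Fixpoint pass q : tangle :=
  if q is q'.+1 then Cross q' true :: Cross q true :: pass q' else [::].

Lemma wt_pass q k : q.+2 <= k -> wt k (pass q) = Some k.
Proof.
elim: q k => [|q IH] k qk //=.
by rewrite ifT ?addnK ?ifT ?addnK ?IH //; lia.
Qed.

Lemma red_pass_far g q : q.+2 <= gpos g ->
  red (g :: pass q) (rcons (pass q) g).
Proof.
move=> qg; have [_] := red_far_word [:: setpos g (gpos g - q.+2)] (wt_pass (leqnn q.+2)).
rewrite /sh /= cats1; set g' := setpos g _.
have -> // : setpos g' (gpos g' + q.+2) = g.
by case: g qg @g' => [i|i|i s] /= qg; rewrite subnK.
Qed.

Lemma red_cross_comm i j s t : i.+2 <= j ->
  red [:: Cross i s; Cross j t] [:: Cross j t; Cross i s] /\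
  red [:: Cross j t; Cross i s] [:: Cross i s; Cross j t].
Proof.
move=> ij; split.
  by apply: (@red_far (Cross i s) (Cross j t) j) => /=; lia.
by apply: (@red_farV (Cross i s) (Cross j t) j) => /=; lia.
Qed.

(** Two slides along the cup turn the four crossings into two cancelling pairs. *)
Lemma red_pair_cup i :
  red [:: Cup i; Cross i.+1 true; Cross i.+2 true; Cross i true; Cross i.+1 true]
      [:: Cup i.+2].
Proof.
have [_ h] := @red_cross_comm i i.+2 true true (leqnn _).
apply: (red_step (u := [:: _; _]) (v := [:: _]) h).
apply: (red_step (u := [::]) (v := [:: _; _; _]) (red_slide_cup i true)).
apply: (red_step (u := [:: _]) (v := [:: _; _]) (red_r2 i false)).
apply: (red_step (u := [::]) (v := [:: _]) (red_slide_cup i.+1 true)).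
apply: (red_step (u := [:: _]) (v := [::]) (red_r2 i.+1 false)).
exact: red_refl.
Qed.

Lemma red_pair_cross i e :
  red [:: Cross i e; Cross i.+1 true; Cross i.+2 true; Cross i true; Cross i.+1 true]
      [:: Cross i.+1 true; Cross i.+2 true; Cross i true; Cross i.+1 true; Cross i.+2 e].
Proof.
have [h hV] := @red_cross_comm i i.+2 true true (leqnn _).
apply: (red_step (u := [:: _; _]) (v := [:: _]) hV).
apply: (red_step (u := [::]) (v := [:: _; _]) (red_r3_up i e)).
apply: (red_step (u := [:: _; _]) (v := [::]) (red_r3_up i.+1 e)).
exact: (@red_ctx [:: _] [:: _; _] _ _ h).
Qed.

(** The pair crosses the strands to the right of [g] by far commutation, then [g] itself by the pair
    lemmas, then the strands to the left of [g]. The first hypothesis admits cups and crossings. *)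
Lemma red_pass_gen k g m : gin g = 0 \/ gout g = 2 -> wt k [:: g] = Some m ->
  red (g :: pass m) (rcons (pass k) (setpos g (gpos g).+2)).
Proof.
(* [d] counts the strands between [g] and the travelling pair. *)
move=> hg /wt1P[gk <-] {m}; have /subnKC := gk; move: (k - _) => d.
elim: d k gk => [|d IH] k gk hk.
  rewrite addn0 in hk; subst k.
  case: g hg gk => [i|i [//|//]|i e] /= _ _; rewrite ?addn0 ?addn2 ?subn0 ?addnK /=.
    apply: (red_step (u := [::]) (v := pass i) (red_pair_cup i)).
    exact: (@red_pass_far (Cup i.+2)).
  apply: (red_step (u := [::]) (v := pass i) (red_pair_cross i e)).
  by do 4 apply: red_cons; apply: (@red_pass_far (Cross i.+2 e)).
case: k => [|k] in gk hk *; first by lia.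
have gk' : gpos g + gin g <= k by lia.
have {IH} := IH k gk'; have -> : k.+1 + gout g - gin g = (k + gout g - gin g).+1 by lia.
move=> /(_ _) IH; rewrite /=.
have h : red [:: g; Cross (k + gout g - gin g) true; Cross (k + gout g - gin g).+1 true]
             [:: Cross k true; Cross k.+1 true; g].
  apply: (red_step (u := [::]) (v := [:: _]) (@red_far g (Cross _ _) k _ _)) => /=; try lia.
  apply: (@red_ctx [:: _] [::] [:: _; _] [:: _; _]).
  by apply: (@red_far g (Cross _ _)); move=> /=; lia.
apply: (red_step (u := [::]) h); do 2 apply: red_cons.
by apply: IH; lia.
Qed.

Lemma red_pass_word k m w : all (fun g => (gin g == 0) || (gout g == 2)) w ->
  wt k w = Some m -> red (w ++ pass m) (pass k ++ sh 2 w).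
Proof.
elim: w k => [|g w IH] k; first by move=> _ [->]; rewrite cats0; apply: red_refl.
move=> /andP[/orP hg aw] /wt_consP[gk hw].
apply: red_trans (red_cons _ (IH _ aw hw)) _.
rewrite /= addn2 -cat_cons -cat_rcons; apply: red_catr; apply: red_pass_gen.
  by case: hg => /eqP; [left|right].
exact/wt1P.
Qed.

(** A crossing between the two travelling strands is carried along, by one braid relation for each
    strand they cross. *)
Lemma red_pass_pair q e : red (Cross q e :: pass q) (rcons (pass q) (Cross 0 e)).
Proof.
elim: q => [|q IH]; first exact: red_refl.
apply: red_trans (@red_ctx [::] (pass q) _ _ (red_r3_down q e)) _.
by do 2 apply: red_cons.
Qed.

(** * Braid words on the leftmost strands *)

Lemma braid_cat k u v : braid k (u ++ v) = braid k u && braid k v.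
Proof. exact: all_cat. Qed.

Lemma braid_cons k i s w : braid k (Cross i s :: w) = (i.+1 < k) && braid k w.
Proof. by []. Qed.

Lemma braid_sh d k w : braid k w -> braid (k + d) (sh d w).
Proof. by elim: w => //= -[//|//|i s] w IH /andP[ik /IH ->] /=; lia. Qed.

Lemma sub_braid k l w : k <= l -> braid k w -> braid l w.
Proof. by move=> kl; apply: sub_all => -[//|//|i s] /= ik; lia. Qed.

Lemma braid_pass q : braid q.+2 (pass q).
Proof.
by elim: q => //= q /(sub_braid (leqnSn _)) IH; apply/and3P; split; rewrite // ltnW.
Qed.

Lemma braid_column k j x : j.+2 <= k -> braid k (column j x).
Proof. by move=> jk; rewrite /column; elim: absz => //= p ->; rewrite jk. Qed.

Lemma sh_column d j x : sh d (column j x) = column (j + d) x.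
Proof. by rewrite /sh /column map_nseq. Qed.

Lemma sh_pos k w : all (fun g => k <= gpos g) w -> exists w', w = sh k w'.
Proof.
elim: w => [|g w IH /= /andP[kg /IH[w' ->]]]; first by exists [::].
exists (setpos g (gpos g - k) :: w') => /=.
by case: g kg => [i|i|i s] /= ki; rewrite subnK.
Qed.

Lemma sh_ge d w : all (fun g => d <= gpos g) (sh d w).
Proof. by elim: w => //= -[i|i|i s] w ->; rewrite /= leq_addl. Qed.

Lemma red_far_braid k u v : braid k u -> all (fun g => k <= gpos g) v ->
  red (u ++ v) (v ++ u) /\ red (v ++ u) (u ++ v).
Proof. by move=> /wt_braid hu /sh_pos[w ->]; apply: red_far_word. Qed.

Lemma red_braid_flip k w : braid k w -> red (w ++ flip w) [::].
Proof.
elim: w => [|[//|//|i s] w IH /= /andP[_ /IH h]]; first by move=> _; apply: red_refl.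
rewrite flip_cons catA; apply: red_trans (red_r2 i s).
exact: (@red_ctx [:: _] [:: _] _ _ h).
Qed.

(** * From side-by-side cups to nested cups *)

Lemma wt_cups s q k : s <= q -> wt q [seq Cup i | i <- iota s k] = Some (q + 2 * k).
Proof.
elim: k s q => [|k IH] s q sq /=; first by rewrite addn0.
by rewrite addn0 sq subn0 IH; [congr Some|]; lia.
Qed.

Lemma wt_comb q k : 0 < q -> wt q (nseq k (Cup 1)) = Some (q + 2 * k).
Proof.
elim: k q => [|k IH] q q0 /=; first by rewrite addn0.
by rewrite q0 subn0 IH; [congr Some|]; lia.
Qed.

(** Later cups are inserted to the left of the first, which therefore ends up rightmost and can be
    raised above all of them. *)
Lemma red_comb k : red (nseq k.+1 (Cup 1)) (rcons (nseq k (Cup 1)) (Cup (2 * k).+1)).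
Proof.
have [_] := red_far_word [:: Cup 0] (@wt_comb 1 k isT).
by rewrite cats1 add1n.
Qed.

(** After the braid relation one crossing is a curl on the left cup. Once it is removed, a slide
    turns the other two crossings into a cancelling pair. *)
Lemma red_cup_braid p :
  red [:: Cup p; Cup p.+2; Cross p.+1 true; Cross p true; Cross p.+1 true]
      [:: Cup p; Cup p.+1].
Proof.
have h1 : red [:: Cup p.+2; Cross p true] [:: Cross p true; Cup p.+2].
  by apply: (@red_farV (Cross p true) (Cup p.+2) p.+2) => /=; lia.
have h2 : red [:: Cup p; Cup p.+2] [:: Cup p; Cup p].
  by apply: (@red_far (Cup p) (Cup p.+2) p) => /=; lia.
apply: (red_step (u := [:: _; _]) (v := [::]) (red_r3V p)).
apply: (red_step (u := [:: _]) (v := [:: _; _]) h1).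
apply: (red_step (u := [::]) (v := [:: _; _; _]) (red_r1_cup p true)).
apply: (red_step (u := [::]) (v := [:: _; _]) h2).
apply: (red_step (u := [:: _]) (v := [:: _]) (red_slide_cup p true)).
apply: (red_step (u := [:: _; _]) (v := [::]) (red_r2 p false)).
exact: red_refl.
Qed.

Definition cups k : tangle := [seq Cup i | i <- iota 0 k].
Definition ramp k : tangle := [seq Cross i true | i <- iota 0 k].

Lemma braid_ramp k : braid k.+1 (ramp k).
Proof. by rewrite /braid /ramp all_map; apply/allP => i; rewrite mem_iota /=; lia. Qed.

Lemma cupsS k : cups k.+1 = Cup 0 :: sh 1 (cups k).
Proof.
rewrite /cups /= -[1]addn0 iotaDl /sh -!map_comp.
by congr cons; apply: eq_map => i /=; rewrite addnC.
Qed.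

Lemma rampS k : ramp k.+1 = Cross 0 true :: sh 1 (ramp k).
Proof.
rewrite /ramp /= -[1]addn0 iotaDl /sh -!map_comp.
by congr cons; apply: eq_map => i /=; rewrite addnC.
Qed.

(* The pair p, p+1 is pulled left and down below everything except the outermost
   cup, where its two strands begin two more nested cups; crossing the left strand
   of the outermost cup costs the two extra crossings. *)
Lemma red_cups_pass k j (p := (2 * k).+1) : j < p ->
  red (cups k.+1 ++ ramp j ++ [:: Cup p; Cup p.+1] ++ pass p)
      (cups k.+3 ++ ramp j.+2).
Proof.
move=> jp; rewrite cupsS; set w := sh 1 (cups k) ++ ramp j.
(* Only the left strand of the outermost cup is counted: [w] stays to the left of the other one, and
   the two new cups lie between [w] and that strand. *)
have hw : wt 1 w = Some p.
  apply: wt_catS (wt_braid (sub_braid jp (braid_ramp j))).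
  by have := wt_sh 1 (@wt_cups 0 0 k (leqnn _)); rewrite !addn1.
have aw : all (fun g => (gin g == 0) || (gout g == 2)) w.
  by rewrite all_cat /sh /cups /ramp !all_map !all_predT.
have [h1 _] := red_far_word [:: Cup 0; Cup 1] hw.
have -> : cups k.+3 ++ ramp j.+2 =
    [:: Cup 0; Cup 1; Cup 2] ++ sh 3 (cups k) ++ pass 1 ++ sh 2 (ramp j).
  by rewrite !cupsS !rampS /= -!/(sh _ _) !sh_sh.
rewrite cat_cons; apply: red_cons; rewrite catA -/w catA.
rewrite /= !add0n !add1n in h1.
apply: red_trans (red_catr _ h1) _ => /=.
do 2 apply: red_cons.
apply: red_trans (red_pass_word aw hw) _.
rewrite /w sh_cat !sh_sh.
(* The crossings of [pass 1] lie to the left of the shifted cups; above these they become the first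
   two crossings of the longer ramp. *)
have [h2 _] := @red_far_braid 3 (pass 1) (sh 3 (cups k)) isT (sh_ge _ _).
by rewrite catA; apply: red_trans (red_catr _ h2) _; rewrite -catA; apply: red_refl.
Qed.


(** * The sorting braid absorbed by the cups *)

(* On the n = 2m+2 columns of a pretzel, gathers the even columns (in reverse
   order) to the left of the odd ones; each even column but the first
   is given a half twist on the way. *)
Fixpoint sortw m : tangle :=
  if m is m'.+1 then sortw m' ++ Cross (4 * m) true :: pass (4 * m) else [::].

Lemma sortwS m :
  sortw m.+1 = sortw m ++ Cross (4 * m.+1) true :: pass (4 * m.+1).
Proof. by []. Qed.

Lemma braid_sortw m : braid (4 * m).+2 (sortw m).
Proof.
elim: m => [|m IH] //; rewrite sortwS braid_cat (sub_braid _ IH); last by lia.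
by rewrite braid_cons ltnSn braid_pass.
Qed.

Definition comb k : tangle := Cup 0 :: nseq k (Cup 1).

Lemma red_comb_sortw m :
  red (comb (2 * m).+1 ++ sortw m) (cups (2 * m).+2 ++ ramp (2 * m)).
Proof.
elim: m => [|m IH]; first exact: red_refl.
set p := (4 * m).+3.
have E1 : (2 * m.+1).+1 = (2 * m).+3 by lia.
have E2 : (2 * (2 * m).+2).+1 = p.+2 by lia.
have E3 : (2 * (2 * m).+1).+1 = p by lia.
have E4 : 4 * m.+1 = p.+1 by lia.
(* The two rightmost cups are raised; they commute with the earlier stages of the sorting braid,
   which stay to their left. *)
have h1 : red (comb (2 * m).+3) (comb (2 * m).+1 ++ [:: Cup p; Cup p.+2]).
  rewrite /comb -E2 -E3 -cat1s -[in X in red _ X]cat1s -catA; apply: red_catl.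
  apply: red_trans (red_comb _) _; rewrite -cats1.
  apply: red_trans (red_catr _ (red_comb _)) _; rewrite -cats1 -catA.
  exact: red_refl.
rewrite E1 sortwS E4.
have h2 : red ([:: Cup p; Cup p.+2] ++ sortw m) (sortw m ++ [:: Cup p; Cup p.+2]).
  by have [] := red_far_word [:: Cup 0; Cup 2]
    (wt_braid (sub_braid (leqnSn _) (braid_sortw m))).
apply: red_trans (red_catr _ h1) _.
have -> (u v w t : tangle) : (u ++ v) ++ w ++ t = u ++ (v ++ w) ++ t by rewrite -!catA.
apply: red_trans (red_ctx _ _ h2) _.
have -> (u v w t : tangle) : u ++ (v ++ w) ++ t = (u ++ v) ++ (w ++ t) by rewrite -!catA.
apply: red_trans (red_catr _ IH) _; rewrite -catA.
(* The half twist of the new stage and the first two crossings of [pass p.+1] form the three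
   crossings that nest the two cups; [pass p] remains. *)
have h3 := @red_catr (pass p) _ _ (red_cup_braid p).
apply: red_trans (red_catl _ (red_catl _ h3)) _.
have -> : 2 * m.+1 = (2 * m).+2 by lia.
by have := @red_cups_pass (2 * m).+1 (2 * m); rewrite E3; apply; lia.
Qed.

(** * Stacked columns sliding around nested caps *)

(** The columns act on disjoint pairs of strands, with [c 0] rightmost and [c m] leftmost, matching
    the descending generators in [beta]. *)
Fixpoint stack (c : nat -> int) m : tangle :=
  if m is m'.+1 then sh 2 (stack c m') ++ column 0 (c m) else column 0 (c 0).

Lemma braid_stack c m : braid (2 * m).+2 (stack c m).
Proof.
elim: m => [|m IH] /=; first exact: braid_column.
by rewrite braid_cat braid_column // andbT mulnSr -!addSn; apply: braid_sh.
Qed.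

(* The word read upside down with positions reflected: what becomes of a braid
   word when it slides around nested caps. *)
Definition turn t (w : tangle) : tangle := rev [seq setpos g (t - gpos g) | g <- w].

Lemma turn_cat t u v : turn t (u ++ v) = turn t v ++ turn t u.
Proof. by rewrite /turn map_cat rev_cat. Qed.

Lemma turn_cons t g w : turn t (g :: w) = turn t w ++ [:: setpos g (t - gpos g)].
Proof. exact: (turn_cat t [:: g]). Qed.

Lemma turn_sh t d w : braid t.+2 w -> turn (t + d + d) (sh d w) = sh d (turn t w).
Proof.
elim: w => [//|[//|//|i s] w IH] /= /andP[it /IH].
rewrite !turn_cons sh_cat => ->; congr (_ ++ [:: Cross _ _]); rewrite /=; lia.
Qed.

Lemma turn_column t j x : turn t (column j x) = column (t - j) x.
Proof. by rewrite /turn /column map_nseq rev_nseq. Qed.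

Lemma turn_ge t k l w : braid k w -> l + k <= t.+2 ->
  all (fun g => l <= gpos g) (turn t w).
Proof.
move=> hw lkt; elim: w hw => [//|[//|//|i s] w IH] /= /andP[ik /IH h].
by rewrite turn_cons all_cat h /=; lia.
Qed.

Lemma braid_turn t w : braid t.+2 w -> braid t.+2 (turn t w).
Proof.
elim: w => [//|[//|//|i s] w IH] /= /andP[ik /IH h].
by rewrite turn_cons braid_cat h /=; lia.
Qed.

Definition caps k : tangle := [seq Cap (k.-1 - i) | i <- iota 0 k].

Lemma capsS k : caps k.+1 = Cap k :: caps k.
Proof.
rewrite /caps /= subn0 -[1]addn0 iotaDl -map_comp; congr cons.
by apply/eq_in_map => i; rewrite mem_iota /= => hi; congr Cap; lia.
Qed.

Lemma flip_cups k : flip (cups k) = caps k.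
Proof.
elim: k => // k IH; rewrite capsS -IH /cups -addn1 iotaD map_cat flip_cat.
by rewrite add0n.
Qed.

(** Caps inside the two that carry the crossing are out of its way. Sliding it past those two
    changes its sign twice, so the sign survives. *)
Lemma red_turn_cross k i s : i.+2 <= k ->
  red (Cross (2 * k - 2 - i) s :: caps k) (Cross i s :: caps k).
Proof.
elim: k => // k IH; rewrite leq_eqVlt => /orP[/eqP [<-]|ik].
  have -> : 2 * i.+2 - 2 - i = i.+2 by lia.
  have hV : red [:: Cap i.+2; Cap i] [:: Cap i; Cap i].
    by apply: (@red_farV (Cap i) (Cap i) i.+2) => /=; lia.
  rewrite !capsS.
  apply: (red_step (u := [::]) (v := _ :: _) (red_slide_cap i.+1 s)).
  apply: (red_step (u := [:: _]) (v := _) hV).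
  apply: (red_step (u := [::]) (v := _ :: _) (red_slide_cap i (~~ s))).
  by rewrite negbK; apply: red_refl.
rewrite capsS; set q := 2 * k - 2 - i.
have h1 : red [:: Cross (2 * k.+1 - 2 - i) s; Cap k] [:: Cap k; Cross q s].
  have -> : 2 * k.+1 - 2 - i = q.+2 by rewrite /q; lia.
  by apply: (@red_farV (Cap k) (Cross q s)) => /=; rewrite /q; lia.
have h2 : red [:: Cap k; Cross i s] [:: Cross i s; Cap k].
  by apply: (@red_farV (Cross i s) (Cap k)) => /=; lia.
apply: (red_step (u := [::]) (v := caps k) h1).
apply: red_trans (red_cons (Cap k) (IH ik)) _.
by apply: (red_step (u := [::]) (v := caps k) h2); apply: red_refl.
Qed.

(** The topmost turned letter, which is the first of [w], slides around first and then drops below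
    the remaining turned letters; this restores the order of [w]. *)
Lemma red_turn k w : braid k w ->
  red (turn (2 * k - 2) w ++ caps k) (w ++ caps k).
Proof.
elim: w => [|[//|//|i s] w IH]; first by move=> _; apply: red_refl.
rewrite braid_cons turn_cons -catA => /andP[ik hw].
apply: red_trans (red_catl _ (red_turn_cross s ik)) _.
have [||_ h] := @red_far_braid i.+2 [:: Cross i s] (turn (2 * k - 2) w).
- by rewrite /= andbT.
- by apply: turn_ge hw _; lia.
rewrite -cat1s catA; apply: red_trans (red_catr _ h) _.
exact: red_cons (IH hw).
Qed.

(** * Columns passing the sorting braid *)

Lemma red_column_cross j x : red (column j x ++ [:: Cross j true]) (Cross j true :: column j x).
Proof.
rewrite /column; set s := (_ < _)%R; elim: absz => [|k IH]; first exact: red_refl.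
apply: red_trans (red_cons _ IH) _.
apply: (@red_ctx [::] (nseq k _) [:: _; _] [:: _; _]).
case: s {IH}; first exact: red_refl.
apply: (@red_span [:: Cross j true; Cross j false; Cross j false; Cross j true]).
- exact: (@red_ctx [::] [:: _; _] _ _ (red_r2 j true)).
- exact: (@red_ctx [:: _; _] [::] _ _ (red_r2 j false)).
- by move=> k' m; wt_lia.
Qed.

Lemma red_column_pass q x : red (column q x ++ pass q) (pass q ++ column 0 x).
Proof.
rewrite /column; elim: absz => [|k IH]; first by rewrite cats0; apply: red_refl.
apply: red_trans (red_cons _ IH) _.
rewrite -cat_cons; apply: red_trans (red_catr _ (red_pass_pair _ _)) _.
by rewrite cat_rcons; apply: red_refl.
Qed.

(** The sorted columns: even ones on the left half in reverse order, odd ones on the right half in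
    their original order. The odd part is written with [turn] so that the caps later make it a plain
    stack. *)
Definition stacks (c : nat -> int) m : tangle :=
  turn (4 * m).+2 (stack (fun k => c (2 * k).+1) m) ++ stack (fun k => c (2 * k)) m.

Lemma stacksS c m : stacks c m.+1 =
  column (4 * m).+3.+3 (c (2 * m).+3) ++ sh 2 (stacks c m) ++ column 0 (c (2 * m).+2).
Proof.
rewrite /stacks [stack _ _]/= turn_cat turn_column subn0.
have -> : (4 * m.+1).+2 = (4 * m).+2 + 2 + 2 by lia.
rewrite turn_sh; last by apply: sub_braid (braid_stack _ _); lia.
rewrite [stack _ m.+1]/= sh_cat -!catA; congr (column _ (c _) ++ _ ++ _ ++ column _ (c _)); lia.
Qed.

Lemma braid_stacks c m : braid (4 * m).+4 (stacks c m).
Proof.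
rewrite braid_cat braid_turn /=; apply: sub_braid (braid_stack _ _); lia.
Qed.

Lemma column_ge k j x : k <= j -> all (fun g => k <= gpos g) (column j x).
Proof. by rewrite /column => kj; elim: absz => //= p ->; rewrite kj. Qed.

Definition columns (c : nat -> int) k : tangle :=
  flatten [seq column (2 * i) (c i) | i <- iota 0 k].

Lemma columnsS c k : columns c k.+1 = columns c k ++ column (2 * k) (c k).
Proof.
by rewrite /columns -[k.+1]addn1 iotaD map_cat flatten_cat /= cats0 add0n.
Qed.

Lemma braid_columns c k : braid (2 * k) (columns c k).
Proof.
elim: k => // k IH; rewrite columnsS braid_cat braid_column ?(sub_braid _ IH) //; lia.
Qed.

Ltac red_at u v h :=
  let H := fresh in
  have H := red_ctx u v h; rewrite ?cats0 ?cat0s -?catA in H;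
  rewrite -?catA; apply: red_trans H _; rewrite -?catA.

Lemma red_columns_sortw c m :
  red (columns c (2 * m).+2 ++ sortw m) (sortw m ++ stacks c m).
Proof.
elim: m => [|m IH].
  rewrite !columnsS cats0 /=.
  have [h _] := red_far_braid (@braid_column 2 0 (c 0) isT) (@column_ge 2 2 (c 1) isT).
  by rewrite /stacks /= turn_column.
have -> : (2 * m.+1).+2 = (2 * m).+4 by lia.
rewrite [X in red (X ++ _)]columnsS [X in red ((X ++ _) ++ _)]columnsS stacksS sortwS.
set C := columns c _; set S := sortw m; set W := stacks c m.
have -> : 4 * m.+1 = (4 * m).+4 by lia.
have -> : 2 * (2 * m).+2 = (4 * m).+4 by lia.
have -> : 2 * (2 * m).+3 = (4 * m).+4.+2 by lia.
set q := (4 * m).+4; set P := pass q; set b := column q.+2 _.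
set a := column q _; set a0 := column 0 _; set X := [:: Cross q true].
rewrite -(cat1s (Cross q true)) -/X.
have hW : braid q W by apply: braid_stacks.
have hb : all (fun g => q.+2 <= gpos g) b by apply: column_ge.
have [_ h1] : red (S ++ a ++ b) ((a ++ b) ++ S) /\ red ((a ++ b) ++ S) (S ++ a ++ b).
  apply: red_far_braid (braid_sortw m) _.
  by rewrite all_cat !column_ge // /q; lia.
have [_ h3] : red ((X ++ P) ++ b) (b ++ X ++ P) /\ red (b ++ X ++ P) ((X ++ P) ++ b).
  by apply: (@red_far_braid q.+2); rewrite // braid_cat braid_pass /= ltnSn.
have [h6 _] : red (W ++ X) (X ++ W) /\ red (X ++ W) (W ++ X).
  by apply: red_far_braid hW _; rewrite /= leqnn.
have [h8 _] : red ((sh 2 W ++ a0) ++ b) (b ++ sh 2 W ++ a0) /\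
              red (b ++ sh 2 W ++ a0) ((sh 2 W ++ a0) ++ b).
  apply: (@red_far_braid q.+2); rewrite // braid_cat braid_column // andbT.
  by rewrite -addn2; apply: braid_sh.
have h7 : red (W ++ P) (P ++ sh 2 W).
  apply: red_pass_word (wt_braid hW); apply: sub_all hW.
  by case.
have h4 : red (a ++ X) (X ++ a) by apply: red_column_cross.
have h5 : red (a ++ P) (P ++ a0) by apply: red_column_pass.
(* With the last even column [a] and the last odd column [b], the word becomes successively
   [C S a b X P], [S W a b X P], [S W a X P b], [S W X a P b], [S W X P a0 b], [S X W P a0 b]; then
   [P] shifts [W] by 2 and [b] drops to the front of the columns. *)
rewrite -/C -/S -/W in IH; clearbody C S W X P a a0 b.
red_at C (X ++ P) h1.
red_at (@nil gen) (a ++ b ++ X ++ P) IH.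
red_at (S ++ W ++ a) (@nil gen) h3.
red_at (S ++ W) (P ++ b) h4.
red_at (S ++ W ++ X) b h5.
red_at S (P ++ a0 ++ b) h6.
red_at (S ++ X) (a0 ++ b) h7.
red_at (S ++ X ++ P) (@nil gen) h8.
exact: red_refl.
Qed.

(** * Translation of the braid word *)

Lemma braid_flip k w : braid k w -> braid k (flip w).
Proof.
elim: w => [//|[//|//|i s] w IH]; rewrite braid_cons => /andP[ik /IH h].
by rewrite flip_cons braid_cat h /= ik.
Qed.

Lemma flip_ramp k : flip (ramp k) = rev [seq Cross i false | i <- iota 0 k].
Proof. by rewrite /flip /ramp -map_comp. Qed.

Lemma flip_comb k : flip (comb k) = nseq k (Cap 1) ++ [:: Cap 0].
Proof. by rewrite flip_cons /flip map_nseq rev_nseq. Qed.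

Lemma map_bgen_bpow k e : map bgen (bpow k.+1 e) = column k e.
Proof.
rewrite /bpow /column map_nseq /bgen.
(* The sign tests in [bpow] and [column] disagree only at 0, where both words are empty. *)
have [->|e0] : e = 0%R \/ e <> 0%R by case: (e =P 0%R); [left|right].
  by [].
by congr (nseq _ (Cross _ _)); case: ifP; lia.
Qed.

Lemma bup_pos k : bup 1 k%:Z = [seq i.+1%:Z%R | i <- iota 0 k].
Proof.
case: k => [//|k]; have h : ((1 <= k.+1%:Z) && (0 < 1 * k.+1%:Z))%R by lia.
rewrite /bup h; have -> : absz (k.+1%:Z - 1)%R = k by lia.
by apply: eq_map => i; lia.
Qed.

Lemma bup_neg k : bup (- k%:Z) (-1) = rev [seq (- i.+1%:Z)%R | i <- iota 0 k].
Proof.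
case: k => [//|k]; have h : ((- k.+1%:Z <= -1) && (0 < - k.+1%:Z * -1))%R by lia.
rewrite /bup h; have -> : absz (-1 - - k.+1%:Z)%R = k by lia.
apply: (@eq_from_nth _ 0%R); rewrite ?size_rev !size_map // size_iota => i ik.
rewrite nth_rev ?size_map ?size_iota // !(nth_map 0) ?size_iota ?nth_iota //; lia.
Qed.

Lemma map_bgen_stack c m :
  map bgen (flatten [seq bpow ((2 * m).+2 - 1 - 2 * k) (c k) | k <- iota 0 m.+1]) = stack c m.
Proof.
rewrite map_flatten -map_comp.
(* Generators count from 1 and positions from 0; on this range no subtraction is truncated. *)
have /eq_in_map-> : {in iota 0 m.+1, map bgen \o (fun k => bpow ((2 * m).+2 - 1 - 2 * k) (c k))
    =1 fun k => column (2 * m - 2 * k) (c k)}.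
  move=> k; rewrite mem_iota /= => km; rewrite -map_bgen_bpow; congr (map _ (bpow _ _)); lia.
elim: m => [|m IH]; first by rewrite /= cats0.
rewrite -[m.+2]addn1 iotaD map_cat flatten_cat [stack _ _]/= -IH; congr (_ ++ _).
  rewrite /sh map_flatten -map_comp; congr flatten; apply/eq_in_map => k.
  rewrite mem_iota /= => km; rewrite -/(sh 2 _) sh_column; congr column; lia.
by rewrite /= cats0 add0n subnn.
Qed.

(** * The isotopy between the two diagrams *)

Lemma iso_sorted c m (n := (2 * m).+2) :
  iso (comb n.-1 ++ columns c n ++ flip (comb n.-1))
      (cups n ++ (ramp (2 * m) ++ stack (fun k => c (2 * k)) m ++
         flip (ramp (2 * m)) ++ stack (fun k => c (2 * k).+1) m) ++ caps n).
Proof.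
set K := comb _; set C := columns _ _; set R := ramp _; set S := sortw m.
set E := stack _ _; set O := stack _ _.
(* Since [red] is directed, the isotopy is obtained from two reductions of the common closed word
   [Z]. *)
pose Z := K ++ C ++ S ++ flip S ++ flip K.
have hK : wt 0 K = Some (2 * n).
  rewrite /K /comb -cat1s; apply: (@wt_catS _ 2) => //.
  by rewrite wt_comb //; congr Some; rewrite /n; lia.
have hC : braid (2 * n) C by apply: braid_columns.
have hS : wt (2 * n) S = Some (2 * n).
  by apply/wt_braid/(sub_braid _ (braid_sortw m)); lia.
have hZ : wt 0 Z = Some 0.
  apply: (wt_catS hK); apply: (wt_catS (wt_braid hC)); apply: (wt_catS hS).
  exact: wt_catS (wt_flip hS) (wt_flip hK).
have h1 : red Z (K ++ C ++ flip K).
  have h : red (S ++ flip S) [::] := red_braid_flip (braid_sortw m).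
  by rewrite /Z; red_at (K ++ C) (flip K) h; apply: red_refl.
have hE : braid n (E ++ flip R).
  by rewrite braid_cat braid_stack (sub_braid _ (braid_flip (braid_ramp _))).
have h2 : red Z (cups n ++ (R ++ E ++ flip R ++ O) ++ caps n).
  have hCS : red (C ++ S) (S ++ stacks c m) by apply: red_columns_sortw.
  have hKS : red (K ++ S) (cups n ++ R) by apply: red_comb_sortw.
  have hSK : red (flip S ++ flip K) (flip R ++ caps n).
    by rewrite -flip_cups -!flip_cat; apply: red_flip.
  (* The turned odd columns use positions from [n] on, so they rise past [E] and [flip R] to meet
     the caps. *)
  have [_ hOE] : red ((E ++ flip R) ++ turn (4 * m).+2 O) (turn (4 * m).+2 O ++ E ++ flip R) /\
                 red (turn (4 * m).+2 O ++ E ++ flip R) ((E ++ flip R) ++ turn (4 * m).+2 O).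
    by apply: red_far_braid hE _; apply: (turn_ge (braid_stack _ _)); rewrite /n; lia.
  have hO : red (turn (4 * m).+2 O ++ caps n) (O ++ caps n).
    have -> : (4 * m).+2 = 2 * n - 2 by rewrite /n; lia.
    exact/red_turn/braid_stack.
  rewrite /stacks -/E -/O in hCS.
  rewrite /Z; move: (turn _ _) hCS hOE hO => T; move: (caps n) (cups n) hKS hSK => D U.
  clearbody K C R S E O => hKS hSK hCS hOE hO.
  red_at K (flip S ++ flip K) hCS.
  red_at (@nil gen) (T ++ E ++ flip S ++ flip K) hKS.
  red_at (U ++ R ++ T ++ E) (@nil gen) hSK.
  red_at (U ++ R) D hOE.
  red_at (U ++ R ++ E ++ flip R) (@nil gen) hO.
  exact: red_refl.
have [_ i1] := redP h1 (u := [::]) (v := [::]) (erefl _) hZ (erefl _).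
have [_ i2] := redP h2 (u := [::]) (v := [::]) (erefl _) hZ (erefl _).
rewrite !cats0 /= in i1 i2.
exact: iso_trans (iso_sym i1) i2.
Qed.

(** * Counting crossings, and the theorem *)

Lemma sum_even_odd (F : nat -> nat) m :
  sumn [seq F (2 * k) | k <- iota 0 m] + sumn [seq F (2 * k).+1 | k <- iota 0 m] =
  \sum_(0 <= i < 2 * m) F i.
Proof.
elim: m => [|m IH]; first by rewrite big_nil.
have -> : iota 0 m.+1 = iota 0 m ++ [:: m] by rewrite -[m.+1]addn1 iotaD.
have -> : 2 * m.+1 = (2 * m).+2 by lia.
rewrite !map_cat !sumn_cat /= !big_nat_recr // -IH /=; lia.
Qed.

Lemma size_bpows f (c : nat -> int) s :
  size (flatten [seq bpow (f k) (c k) | k <- s]) = sumn [seq absz (c k) | k <- s].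
Proof.
rewrite size_flatten /shape -map_comp; congr sumn.
by apply: eq_map => k; rewrite /= size_nseq.
Qed.

Lemma all_bpows n f (c : nat -> int) s : all (fun k => 0 < f k < n) s ->
  all (fun x => (0 < absz x) && (absz x < n)) (flatten [seq bpow (f k) (c k) | k <- s]).
Proof.
elim: s => //= k s IH /andP[kn /IH h]; rewrite all_cat h andbT.
by rewrite all_nseq; apply/orP; right; case: ifP; lia.
Qed.

Theorem theorem2 (n : nat) (a : seq int) :
  (2 < n)%N -> ~~ odd n -> size a = n ->
  iso (pretzel a) (bclosure n (beta n a))
  /\ all (fun m : int => ((0 < absz m)%N && (absz m < n)%N)) (beta n a)
  /\ size (beta n a) = (2 * n + \sum_(x <- a) absz x - 4)%N.
Proof.
(* [m] is the number of even columns other than the first, that is, of stages of the sorting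
   braid. *)
move=> n2 n_even sza; pose c := nth 0%R a; pose m := n./2.-1.
have nE : n = (2 * m).+2 by rewrite /m; lia.
have hm : n./2 = m.+1 by lia.
have hb : beta n a = bup 1 (Posz (2 * m))
    ++ flatten [seq bpow (n - 1 - 2 * k) (c (2 * k)) | k <- iota 0 m.+1]
    ++ bup (- Posz (2 * m)) (-1)
    ++ flatten [seq bpow (n - 1 - 2 * k) (c (2 * k).+1) | k <- iota 0 m.+1].
  by rewrite /beta hm; have -> : (n%:Z - 2)%R = Posz (2 * m) by lia.
rewrite hb bup_pos bup_neg; split; [|split].
- have -> : pretzel a = comb n.-1 ++ columns c n ++ flip (comb n.-1).
    by rewrite /pretzel sza flip_comb.
  have := iso_sorted c m; rewrite -nE /bclosure 3!map_cat -/(cups n) -/(caps n).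
  congr (iso _ (_ ++ (_ ++ _ ++ _ ++ _) ++ _)).
  + by rewrite /ramp -map_comp.
  + by rewrite nE -(map_bgen_stack (fun k => c (2 * k))).
  + by rewrite flip_ramp map_rev -map_comp.
  + by rewrite nE -(map_bgen_stack (fun k => c (2 * k).+1)).
- have hp c' : all (fun x : int => (0 < absz x) && (absz x < n))
      (flatten [seq bpow (n - 1 - 2 * k) (c' k) | k <- iota 0 m.+1]).
    (* Here [k] is at most [m], so the generator index is at least 1. *)
    by apply: all_bpows; apply/allP => k; rewrite mem_iota; lia.
  rewrite 3!all_cat hp (hp (fun k => c (2 * k).+1)) all_rev 2!all_map andbT.
  by apply/andP; split; apply/allP => i; rewrite mem_iota /=; lia.
(* The two outer runs contribute [2 * m] crossings each, in total [2 * n - 4]. *)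
- rewrite 3!size_cat size_rev 2!size_map size_iota (size_bpows _ (fun k => c (2 * k))).
  rewrite (size_bpows _ (fun k => c (2 * k).+1)) (big_nth 0%R) sza nE.
  have -> : (2 * m).+2 = 2 * m.+1 by lia.
  rewrite -(sum_even_odd (fun i => absz (c i))); lia.
Qed.
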